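(* Let $n\ge1$ and let $\{\mathbf{s}_1,\dots,\mathbf{s}_M\}\subset\mathbb{R}^n$ be an arbitrary constellation of $M\ge2$ distinct points, used over the AWGN channel with maximum-likelihood detection. Then for all SNR $\gamma>0$, $$\frac{B_l}{\gamma^2}\le\frac{d^2P_e}{d\gamma^2}\le\frac{B_u}{\gamma^2},$$ and the same bounds hold for $d^2P_{ei}/d\gamma^2$ for every $i$, where $$B_u=\frac{2+\sqrt{2n}}{2}\cdot\frac{u_n^{n/2}e^{-u_n}}{\Gamma(n/2)},\quad u_n=\frac{n+\sqrt{2n}}{2},$$ $$B_l=0\ \text{ if } n\le 2,\qquad B_l=-\frac{\sqrt{2n}-2}{2}\cdot\frac{l_n^{n/2}e^{-l_n}}{\Gamma(n/2)},\quad l_n=\frac{n-\sqrt{2n}}{2},\ \text{ if } n>2,$$ and $\Gamma$ is the gamma function.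
   Context: Setting: a constellation is a set of $M\ge2$ distinct points $\mathbf{s}_1,\dots,\mathbf{s}_M\in\mathbb{R}^n$, normalized by $\frac1M\sum_{i=1}^M|\mathbf{s}_i|^2=1$ ($|\cdot|$ is the Euclidean norm). The received vector is $\mathbf{r}=\mathbf{s}+\boldsymbol{\xi}$, where $\mathbf{s}$ is a random constellation point with prior probabilities $\Pr[\mathbf{s}=\mathbf{s}_i]\ge0$ summing to 1 (not depending on the noise), and $\boldsymbol\xi\sim\mathcal N(\mathbf 0,\sigma_0^2\mathbf I)$ is independent of $\mathbf{s}$; SNR $\gamma=1/\sigma_0^2>0$. The maximum-likelihood detector outputs $\hat{\mathbf{s}}=\arg\min_{\mathbf{s}_i}|\mathbf{r}-\mathbf{s}_i|$. The decision region of $\mathbf{s}_i$, with the origin shifted to $\mathbf{s}_i$, is the convex polyhedron $\Omega_i=\{\mathbf{x}\in\mathbb{R}^n:\ (\mathbf{s}_j-\mathbf{s}_i)^T\mathbf{x}\le\frac12|\mathbf{s}_j-\mathbf{s}_i|^2\ \ \forall j\ne i\}$. $P_{ci}(\gamma)=\int_{\Omega_i}\left(\frac{\gamma}{2\pi}\right)^{n/2}e^{-\gamma|\mathbf{x}|^2/2}\,d\mathbf{x}$, $P_{ei}=1-P_{ci}$, $P_e=\sum_{i=1}^M P_{ei}\Pr[\mathbf{s}=\mathbf{s}_i]$. *)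

(* Defs.v *)
From HB Require Import structures.
From mathcomp Require Import all_boot all_order all_algebra.
From mathcomp Require Import all_classical all_reals all_analysis.

Set Implicit Arguments.
Unset Strict Implicit.
Unset Printing Implicit Defensive.
Import Order.TTheory GRing.Theory Num.Theory.
Import numFieldNormedType.Exports.

Local Open Scope classical_set_scope.
Local Open Scope ring_scope.

Definition measure_rV_display : measure_display -> measure_display.
Proof. exact. Qed.

Section measurable_rV.
Context {d} {T : measurableType d} (n : nat).

Let coord (i : 'I_n) (x : 'rV[T]_n) : T := x ord0 i.

Let rV_set0 : g_sigma_preimage coord set0.
Proof. exact: sigma_algebra0. Qed.

Let rV_setC A : g_sigma_preimage coord A -> g_sigma_preimage coord (~` A).
Proof. exact: sigma_algebraC. Qed.

Let rV_bigcup (F : (set 'rV[T]_n)^nat) :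
  (forall i, g_sigma_preimage coord (F i)) ->
  g_sigma_preimage coord (\bigcup_i (F i)).
Proof. exact: sigma_algebra_bigcup. Qed.

(* The product sigma-algebra, generated by the coordinates, as for
   n.-tuple T. *)
HB.instance Definition _ := @isMeasurable.Build (measure_rV_display d)
  'rV[T]_n (g_sigma_preimage coord) rV_set0 rV_setC rV_bigcup.

Lemma measurable_rV_coord (i : 'I_n) :
  measurable_fun [set: 'rV[T]_n] (fun x : 'rV[T]_n => x ord0 i).
Proof.
move=> _ Y mY; rewrite setTI; apply: sub_sigma_algebra => /=.
rewrite -bigcup_seq/=; exists i => /=; first by rewrite mem_index_enum.
by exists Y => //; rewrite setTI.
Qed.

Lemma measurable_fun_rVP d' (T' : measurableType d') (f : T' -> 'rV[T]_n) :
  measurable_fun [set: T'] f <->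
  forall i, measurable_fun [set: T'] (fun t => f t ord0 i).
Proof.
split=> [mf i|mf].
  exact: (measurableT_comp (measurable_rV_coord i)).
have S : g_sigma_preimage coord `<=` [set A | measurable (f @^-1` A)].
  apply: smallest_sub.
    split => /=.
    - by rewrite preimage_set0.
    - by move=> A mA; rewrite setTD preimage_setC; exact: measurableC.
    - by move=> F mF; rewrite preimage_bigcup; exact: bigcup_measurable.
  rewrite -bigcup_seq => A [i _ [B mB <-]] /=.
  rewrite setTI.
  by have := mf i measurableT _ mB; rewrite setTI.
by move=> _ A mA; rewrite setTI; exact: S.
Qed.

End measurable_rV.

Section lebesgue_rV.
Context {R : realType}.
Local Open Scope ereal_scope.
Local Notation leb :=
  (lebesgue_measure : {sigma_finite_measure set (measurableTypeR R) -> \bar R}).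

Definition rV_cons n (p : R * 'rV[R]_n) : 'rV[R]_n.+1 :=
  row_mx (const_mx p.1 : 'rV_1) p.2.

Definition rV_uncons n (x : 'rV[R]_n.+1) : R * 'rV[R]_n :=
  (x ord0 ord0, rsubmx (x : 'rV_(1 + n))).

Lemma rV_cons0 n (p : R * 'rV[R]_n) : rV_cons p ord0 ord0 = p.1.
Proof.
have -> : ord0 = lshift n (ord0 : 'I_1) :> 'I_(1 + n) by exact/val_inj.
by rewrite [LHS]row_mxEl mxE.
Qed.

Lemma rV_consS n (p : R * 'rV[R]_n) (i : 'I_n) :
  rV_cons p ord0 (lift ord0 i) = p.2 ord0 i.
Proof.
have -> : lift ord0 i = rshift 1 i :> 'I_(1 + n) by exact/val_inj.
by rewrite [LHS]row_mxEr.
Qed.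

Lemma rV_consK n : cancel (@rV_cons n) (@rV_uncons n).
Proof. by case=> a v; rewrite /rV_uncons rV_cons0 [rsubmx _]row_mxKr. Qed.

Lemma measurable_rV_cons n : measurable_fun [set: R * 'rV[R]_n] (@rV_cons n).
Proof.
apply/measurable_fun_rVP => i; have [j ->|->] := unliftP ord0 i.
  under eq_fun do rewrite rV_consS.
  exact: (measurableT_comp (measurable_rV_coord j)).
under eq_fun do rewrite rV_cons0.
exact: measurable_fst.
Qed.

Lemma measurable_rV_uncons n : measurable_fun [set: 'rV[R]_n.+1] (@rV_uncons n).
Proof.
apply: measurable_fun_pair; first exact: measurable_rV_coord.
apply/measurable_fun_rVP => i.
rewrite (_ : (fun _ => _) = fun x : 'rV[R]_n.+1 => x ord0 (rshift 1 i)).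
  exact: measurable_rV_coord.
by apply/funext => x; rewrite !mxE.
Qed.

Section lebesgue_rVS.
Variables (n : nat) (m : {sigma_finite_measure set 'rV[R]_n -> \bar R}).

Definition lebesgue_rVS : set 'rV[R]_n.+1 -> \bar R :=
  pushforward (leb \x m) (@rV_cons n).

Let measurable_preimage A : measurable A -> measurable (@rV_cons n @^-1` A).
Proof.
by move=> mA; rewrite -[X in measurable X]setTI; exact: measurable_rV_cons.
Qed.

Let lebesgue_rVS0 : lebesgue_rVS set0 = 0.
Proof. by rewrite /lebesgue_rVS /pushforward preimage_set0 measure0. Qed.

Let lebesgue_rVS_ge0 A : 0 <= lebesgue_rVS A.
Proof. by rewrite /lebesgue_rVS /pushforward; exact: measure_ge0. Qed.

Let lebesgue_rVS_sigma_additive : semi_sigma_additive lebesgue_rVS.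
Proof.
move=> F mF tF mUF; rewrite /lebesgue_rVS /pushforward preimage_bigcup.
apply: measure_semi_sigma_additive => //.
- by move=> i; exact: measurable_preimage.
- apply/trivIsetP => /= i j _ _ ij; rewrite -preimage_setI.
  by move/trivIsetP : tF => /(_ _ _ _ _ ij) ->//; rewrite preimage_set0.
- by rewrite -preimage_bigcup; exact: measurable_preimage.
Qed.

HB.instance Definition _ := isMeasure.Build _ _ _ lebesgue_rVS
  lebesgue_rVS0 lebesgue_rVS_ge0 lebesgue_rVS_sigma_additive.

Let lebesgue_rVS_sigma_finite : sigma_finite setT lebesgue_rVS.
Proof.
have /sigma_finiteP[F [TF ndF Foo]] := sigma_finiteT leb.
have /sigma_finiteP[G [TG ndG Goo]] := sigma_finiteT m.
exists (fun k => @rV_uncons n @^-1` (F k `*` G k)).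
  apply/esym; rewrite -subTset => x _.
  have [i _ Fi] : (\bigcup_i F i) (rV_uncons x).1 by rewrite -TF.
  have [j _ Gj] : (\bigcup_i G i) (rV_uncons x).2 by rewrite -TG.
  exists (maxn i j) => //; split.
  - by move: Fi; exact/subsetPset/ndF/leq_maxl.
  - by move: Gj; exact/subsetPset/ndG/leq_maxr.
move=> k; have [mF Fk] := Foo k; have [mG Gk] := Goo k; split.
  rewrite -[X in measurable X]setTI; apply: measurable_rV_uncons => //.
  exact: measurableX.
rewrite /= /lebesgue_rVS /pushforward -comp_preimage (_ : _ \o _ = id); last first.
  by apply/funext => p; exact: rV_consK.
by rewrite [ltLHS]product_measure1E// lte_mul_pinfty// ge0_fin_numE.
Qed.

HB.instance Definition _ := Measure_isSigmaFinite.Build _ _ _ lebesgue_rVS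
  lebesgue_rVS_sigma_finite.

End lebesgue_rVS.

(* n-fold product of the one-dimensional Lebesgue measure *)
Fixpoint lebesgue_rV (n : nat) : {sigma_finite_measure set 'rV[R]_n -> \bar R} :=
  match n return {sigma_finite_measure set 'rV[R]_n -> \bar R} with
  | 0 => \d_(0%R : 'rV[R]_0)
  | n.+1 => lebesgue_rVS (lebesgue_rV n)
  end.

Lemma lebesgue_rV_box n (A : 'I_n -> set R) : (forall i, measurable (A i)) ->
  lebesgue_rV n [set x | forall i, A i (x ord0 i)] = \prod_(i < n) leb (A i).
Proof.
elim: n A => [|n IHn] A mA.
  by rewrite big_ord0 /= diracE mem_set// => -[].
rewrite big_ord_recl -IHn//= /lebesgue_rVS /pushforward.
have mB : measurable [set x : 'rV[R]_n | forall i, A (lift ord0 i) (x ord0 i)].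
  rewrite (_ : mkset _ = \bigcap_(i in [set: 'I_n])
      ((fun x : 'rV[R]_n => x ord0 i) @^-1` A (lift ord0 i))).
    apply: fin_bigcap_measurable => [|i _]; first exact: finite_finset.
    by rewrite -[X in measurable X]setTI; exact: measurable_rV_coord.
  by apply/seteqP; split => [x Ax i _|x Ax i]; exact: Ax.
rewrite -product_measure1E//; last exact: mA.
apply: (congr1 (leb \x lebesgue_rV n)).
apply/seteqP; split => [[a v] /= H|[a v] /= [Ha Hv] i].
  split; first by have := H ord0; rewrite rV_cons0.
  by move=> i; have := H (lift ord0 i); rewrite rV_consS.
by have [j ->|->] := unliftP ord0 i; rewrite ?rV_cons0 ?rV_consS.
Qed.

End lebesgue_rV.

Section awgn.
Context {R : realType}.

(* The library's norm `|x| on 'rV[R]_n is the max norm. *)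
Definition enorm n (x : 'rV[R]_n) : R := Num.sqrt (\sum_(k < n) x ord0 k ^+ 2).

Definition Gamma (a : R) : R :=
  \int[lebesgue_measure]_(t in `]0, +oo[) (t `^ (a - 1) * expR (- t)).

Definition constellation n M (s : 'I_M -> 'rV[R]_n) : Prop :=
  [/\ (2 <= M)%N, injective s &
      M%:R^-1 * \sum_(i < M) enorm (s i) ^+ 2 = 1].

Definition prior M (p : 'I_M -> R) : Prop :=
  (forall i, 0 <= p i) /\ \sum_(i < M) p i = 1.

Section error_probability.
Variables (n M : nat) (s : 'I_M -> 'rV[R]_n).

(* Maximum-likelihood decision region of s i, with the origin shifted to s i *)
Definition decision_region (i : 'I_M) : set 'rV[R]_n :=
  [set x | forall j, j != i ->
    ((s j - s i) *m x^T) ord0 ord0 <= 2^-1 * enorm (s j - s i) ^+ 2].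

(* In all that follows g is the SNR, the inverse of the noise variance per
   dimension. *)
Definition noise_density (g : R) (x : 'rV[R]_n) : R :=
  (g / (2 * pi)) `^ (n%:R / 2) * expR (- (g * enorm x ^+ 2 / 2)).

Definition Pc (i : 'I_M) (g : R) : R :=
  \int[lebesgue_rV n]_(x in decision_region i) noise_density g x.

Definition Pe (i : 'I_M) (g : R) : R := 1 - Pc i g.

Definition Pe_avg (p : 'I_M -> R) (g : R) : R := \sum_(i < M) Pe i g * p i.

End error_probability.

Definition u_ (n : nat) : R := (n%:R + Num.sqrt (2 * n%:R)) / 2.

Definition l_ (n : nat) : R := (n%:R - Num.sqrt (2 * n%:R)) / 2.

Definition Bu (n : nat) : R :=
  (2 + Num.sqrt (2 * n%:R)) / 2 *
  (u_ n `^ (n%:R / 2) * expR (- u_ n) / Gamma (n%:R / 2)).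

Definition Bl (n : nat) : R :=
  if (n <= 2)%N then 0 else
  - ((Num.sqrt (2 * n%:R) - 2) / 2) *
  (l_ n `^ (n%:R / 2) * expR (- l_ n) / Gamma (n%:R / 2)).

(* f^`(2) is total, with a junk value where f is not twice derivable: this says
   that it is a genuine second derivative at g. *)
Definition twice_derivable (f : R -> R) (g : R) : Prop :=
  (\forall t \near g, derivable f t 1) /\ derivable (f^`())%classic g 1.

End awgn.

(* Main.v *)
(* Let T(x) = |x|^2/2, let S be the decision region (star-shaped about 0), let
   h(t) = e^{-t}(t + 1 - n/2) and J(g) = g^{n/2} \int_S h(g T).  Up to the
   factor (2 pi)^{-n/2}, g^2 Pe''(g) is g J'(g): this is the divergence theorem
   for the radial field x h(g T).  Rescaling the variable, for y < g,
     J(g) - J(y) = g^{n/2} \int_{S \ cS} h(g T)   with c = sqrt (y / g),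
   and t^{n/2} h(t) lies between Bl Gamma(n/2) and Bu Gamma(n/2), so it remains
   to bound \int_{S \ cS} T^{-n/2}.  This weight is invariant under dilations:
   cutting S \ cS along the shells c^{k+1} <= sqrt T < c^k and dilating every
   piece into the shell k = 0 gives disjoint sets, so the integral is at most
   V(c^{-n} - 1), where V is the volume of {T < 1}.  No polar coordinates are
   needed, and V (n/2) Gamma(n/2) = (2 pi)^{n/2} by the layer cake formula. *)
Require Import Defs.
From mathcomp Require Import all_boot all_order all_algebra.
From mathcomp Require Import all_classical all_reals all_analysis.
From mathcomp Require Import measurable_realfun.
From mathcomp Require Import ring lra.
Import Order.TTheory GRing.Theory Num.Theory.
Import numFieldNormedType.Exports.
Local Open Scope classical_set_scope.
Local Open Scope ring_scope.

Set Implicit Arguments.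
Unset Strict Implicit.
Unset Printing Implicit Defensive.

(** * Dilations and Lebesgue measure *)

Section quasi_invariant.
Context d (T : measurableType d) (R : realType).
Variables (mu : {measure set T -> \bar R}) (phi : T -> T) (k : {nonneg R}).
Hypothesis mphi : measurable_fun [set: T] phi.
Hypothesis mu_phi : forall A, measurable A ->
  mu (phi @^-1` A) = (k%:num%:E * mu A)%E.
Local Open Scope ereal_scope.

(** By [mu_phi] the pushforward of [mu] along [phi] is [k] times [mu], so this is integration
    against a pushforward. The intended [phi] are dilations. *)
Lemma ge0_integral_quasi_invariant (D : set T) (f : T -> \bar R) :
  measurable D -> measurable_fun D f -> (forall x, D x -> 0 <= f x) ->
  \int[mu]_(x in phi @^-1` D) f (phi x) = k%:num%:E * \int[mu]_(x in D) f x.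
Proof.
move=> mD mf f0.
rewrite -(ge0_integral_mscale mu mD k mf f0).
rewrite -[LHS](ge0_integral_pushforward mphi mu mD mf); last first.
  by move=> y; rewrite inE; exact: f0.
by apply: eq_measure_integral => A mA _; exact: mu_phi.
Qed.

(** Treat positive and negative parts separately; integrability makes both integrals finite, so [k]
    distributes over their difference. *)
Lemma Rintegral_quasi_invariant (D : set T) (f : T -> R) :
  measurable D -> mu.-integrable D (EFin \o f) ->
  (\int[mu]_(x in phi @^-1` D) f (phi x) = k%:num * \int[mu]_(x in D) f x)%R.
Proof.
move=> mD intf; rewrite /Rintegral.
have mf := measurable_int mu intf.
rewrite [X in fine X = _]integralE [X in _ = (_ * fine X)%R]integralE.
transitivity (fine (k%:num%:E * \int[mu]_(x in D) (EFin \o f)^\+ x -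
    k%:num%:E * \int[mu]_(x in D) (EFin \o f)^\- x)).
  congr (fine (_ - _)).
    rewrite -(ge0_integral_quasi_invariant mD (measurable_funepos mf))//.
    by apply: eq_integral => x _; rewrite !unlock.
  rewrite -(ge0_integral_quasi_invariant mD (measurable_funeneg mf))//.
  by apply: eq_integral => x _; rewrite !unlock.
have p1 := integrable_pos_fin_num mD intf.
have p2 := integrable_neg_fin_num mD intf.
rewrite -muleBr//; first by rewrite fineM// fin_numB p1 p2.
by rewrite fin_num_adde_defr.
Qed.

End quasi_invariant.

Section lebesgue_rV_scaling.
Context {R : realType}.
Local Open Scope ereal_scope.
Local Notation leb :=
  (lebesgue_measure : {sigma_finite_measure set (measurableTypeR R) -> \bar R}).

(** Uniqueness of Lebesgue measure: [c] times its pushforward along multiplication by [c] gives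
    every half-open interval its length. *)
Lemma lebesgue_measure_scale (c : R) (A : set (measurableTypeR R)) :
  (0 < c)%R -> measurable A ->
  leb ((fun x : measurableTypeR R => c * x)%R @^-1` A) = (c^-1)%:E * leb A.
Proof.
move=> c0 mA.
pose k := NngNum (ltW c0).
pose f (x : measurableTypeR R) : measurableTypeR R := (c * x)%R.
have mf : measurable_fun [set: measurableTypeR R] f by exact: mulrl_measurable.
have -> : leb A = pushforward (mscale k leb) f A.
  apply: lebesgue_measure_unique => // _ [[a b]] _ <-.
  rewrite [RHS](_ : _ = c%:E * lebesgue_measure (f @^-1` `]a, b]))//.
  have -> : f @^-1` `]a, b] = `](a / c)%R, (b / c)%R]%classic.
    by apply/seteqP; split => x /=;
      rewrite !in_itv/= /f ltr_pdivrMr// ler_pdivlMr// mulrC.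
  rewrite !lebesgue_measure_itv/= !lte_fin ltr_pM2r ?invr_gt0//.
  case: ifPn => _; last by rewrite mule0.
  by rewrite -!EFinD -EFinM; congr (_%:E); field; rewrite gt_eqF.
rewrite [pushforward _ _ _](_ : _ = c%:E * leb (f @^-1` A))//.
by rewrite muleA -EFinM mulVf ?gt_eqF// mul1e.
Qed.

Lemma measurable_rV_scale n (c : R) :
  measurable_fun [set: 'rV[R]_n] (fun x : 'rV[R]_n => c *: x).
Proof.
apply/measurable_fun_rVP => i; under eq_fun do rewrite mxE.
apply: measurable_funM => //; exact: measurable_rV_coord.
Qed.

Lemma rV_consZ n (c a : R) (v : 'rV[R]_n) :
  rV_cons ((c * a)%R, c *: v) = c *: rV_cons (a, v).
Proof.
apply/rowP => i.
rewrite [RHS]mxE.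
change (rV_cons (c * a, c *: v)%R ord0 i = c * rV_cons (a, v) ord0 i)%R.
by have [j ->|->] := unliftP ord0 i;
  rewrite ?rV_cons0 ?rV_consS /= ?mxE.
Qed.

(** Induction on the dimension: the section at [a] of the dilated set is the dilate of the section
    of [B] at [c * a]. The fibre contributes [c ^- n], the change of variable in [a] one more factor
    [c^-1]. *)
Lemma lebesgue_rV_scale n (c : R) (A : set 'rV[R]_n) :
  (0 < c)%R -> measurable A ->
  lebesgue_rV n ((fun x => c *: x) @^-1` A) = (c ^- n)%:E * lebesgue_rV n A.
Proof.
move=> c0; elim: n A => [|n IHn] A mA.
  rewrite expr0 invr1 mul1e; congr (lebesgue_rV 0 _).
  by apply/seteqP; split=> x /=; rewrite (_ : c *: x = x)//;
    apply/rowP; case.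
rewrite /= /lebesgue_rVS /pushforward.
have mB : measurable (@rV_cons R n @^-1` A).
  by rewrite -[X in measurable X]setTI; exact: measurable_rV_cons.
set B := @rV_cons R n @^-1` A in mB *.
rewrite /product_measure1 /=.
pose F (a : measurableTypeR R) := lebesgue_rV n (xsection B a).
have mF : measurable_fun [set: measurableTypeR R] F
  by exact: measurable_fun_xsection.
transitivity (\int[leb]_a ((c ^- n)%:E * F (c * a)%R)).
  apply: eq_integral => a _; rewrite -IHn; last exact: measurable_xsection.
  by congr (lebesgue_rV n _); apply/seteqP; split => v;
    rewrite /xsection /= !inE /B /= rV_consZ.
rewrite ge0_integralZl//.
- have := @ge0_integral_quasi_invariant _ _ _ leb (fun x : measurableTypeR R =>
  c * x)%R
    (NngNum (ltW (etrans (invr_gt0 c) c0))) (mulrl_measurable _)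
    (fun A mA => lebesgue_measure_scale c0 mA) setT F measurableT mF.
  rewrite preimage_setT => ->; last by move=> x _; exact: measure_ge0.
  by rewrite muleA -EFinM exprSr invfM.
- exact: measurableT_comp mF (mulrl_measurable _).
- by rewrite lee_fin invr_ge0 exprn_ge0// ltW.
Qed.
End lebesgue_rV_scaling.

(** * Gaussian integrals *)

Section energy.
Context {R : realType}.
Local Notation leb :=
  (lebesgue_measure : {sigma_finite_measure set (measurableTypeR R) -> \bar R}).

(** The function T of the header; the noise density is proportional to e^{-g T}. *)
Definition energy n (x : 'rV[R]_n) : R := enorm x ^+ 2 / 2.

Lemma energyE n (x : 'rV[R]_n) : energy x = (\sum_(k < n) x ord0 k ^+ 2) / 2.
Proof.
by rewrite /energy /enorm sqr_sqrtr// sumr_ge0// => i _; exact: sqr_ge0.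
Qed.

Lemma energy_ge0 n (x : 'rV[R]_n) : 0 <= energy x.
Proof. by rewrite /energy divr_ge0// sqr_ge0. Qed.

Lemma energyZ n (c : R) (x : 'rV[R]_n) : energy (c *: x) = c ^+ 2 * energy x.
Proof.
rewrite !energyE mulrA mulr_sumr; congr (_ / _).
by apply: eq_bigr => i _; rewrite mxE exprMn.
Qed.

Lemma energy_eq0 n (x : 'rV[R]_n) : energy x = 0 -> x = 0.
Proof.
rewrite energyE => /eqP; rewrite mulf_eq0 invr_eq0 pnatr_eq0 orbF.
rewrite psumr_eq0 => [/allP x0|i _]; last exact: sqr_ge0.
apply/rowP => i; rewrite mxE.
have := x0 i; rewrite mem_index_enum => /(_ isT).
by rewrite /= sqrf_eq0 => /eqP.
Qed.

Lemma measurable_energy n : measurable_fun [set: 'rV[R]_n] (@energy n).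
Proof.
rewrite (_ : @energy n = fun x => (\sum_(k < n) x ord0 k ^+ 2) / 2); last first.
  by apply/funext => x; exact: energyE.
apply: measurable_funM => //; apply: measurable_sum => i.
by apply: measurable_funX; exact: measurable_rV_coord.
Qed.

Lemma energy_cons n (a : R) (v : 'rV[R]_n) :
  energy (rV_cons (a, v)) = a ^+ 2 / 2 + energy v.
Proof.
rewrite !energyE big_ord_recl rV_cons0 mulrDl; congr (_ + _ / _).
by apply: eq_bigr => i _; rewrite rV_consS.
Qed.

Lemma ge0_integral_rV_scale n (c : R) (D : set 'rV[R]_n) (f :
  'rV[R]_n -> \bar R) :
  0 < c -> measurable D -> measurable_fun D f -> (forall x, D x -> (0 <=
    f x)%E) ->
  (\int[lebesgue_rV n]_(x in (fun x => c *: x) @^-1` D) f (c *: x) =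
   (c ^- n)%:E * \int[lebesgue_rV n]_(x in D) f x)%E.
Proof.
move=> c0 mD mf f0.
have k0 : 0 <= c ^- n by rewrite invr_ge0 exprn_ge0// ltW.
exact: (@ge0_integral_quasi_invariant _ _ _ (lebesgue_rV n) (fun x => c *: x)
  (NngNum k0) (measurable_rV_scale _) (fun A mA => lebesgue_rV_scale c0 mA)).
Qed.

Lemma Rintegral_rV_scale n (c : R) (D : set 'rV[R]_n) (f : 'rV[R]_n -> R) :
  0 < c -> measurable D -> (lebesgue_rV n).-integrable D (EFin \o f) ->
  \int[lebesgue_rV n]_(x in (fun x => c *: x) @^-1` D) f (c *: x) =
   c ^- n * \int[lebesgue_rV n]_(x in D) f x.
Proof.
move=> c0 mD intf.
have k0 : 0 <= c ^- n by rewrite invr_ge0 exprn_ge0// ltW.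
exact: (@Rintegral_quasi_invariant _ _ _ (lebesgue_rV n) (fun x => c *: x)
  (NngNum k0) (measurable_rV_scale _) (fun A mA => lebesgue_rV_scale c0 mA)).
Qed.

(** Read off from the total mass 1 of the standard normal density. *)
Lemma integral_expRN_sqr_half :
  (\int[leb]_x (expR (- (x ^+ 2 / 2)))%:E = (Num.sqrt (2 * pi))%:E)%E.
Proof.
have s0 : 0 < Num.sqrt (2 * pi) :> R by rewrite sqrtr_gt0 mulr_gt0// pi_gt0.
have -> : (\int[leb]_x (expR (- (x ^+ 2 / 2)))%:E =
    \int[leb]_x (normal_fun 0 1 x)%:E)%E.
  by apply: eq_integral => x _; rewrite /normal_fun subr0 expr1n mulNr.
have := integral_normal_pdf (0 : R) (1 : R).
under eq_integral do rewrite normal_pdfE// EFinM.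
rewrite ge0_integralZl//; last 3 first.
- by apply/measurable_EFinP; exact: measurable_normal_fun.
- by move=> x _; rewrite lee_fin normal_fun_ge0.
- by rewrite lee_fin normal_peak_ge0.
rewrite /normal_peak expr1n mul1r -mulr_natl.
move=> /(congr1 (fun z => (Num.sqrt (2 * pi))%:E * z)%E).
by rewrite muleA -EFinM divff ?gt_eqF// mul1e mule1.
Qed.

Lemma measurable_expRN_energy n (c : R) :
  measurable_fun [set: 'rV[R]_n] (fun x => expR (- (c * energy x))).
Proof.
apply: measurableT_comp => //; apply: measurable_funN;
  apply: measurable_funM => //.
exact: measurable_energy.
Qed.

Lemma measurable_EFin_expRN_energy n :
  measurable_fun [set: 'rV[R]_n] (fun x => (expR (- energy x))%:E).
Proof.
apply/measurable_EFinP.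
by under eq_fun do rewrite -[energy _]mul1r; exact: measurable_expRN_energy.
Qed.

(** The energy is additive over coordinates, so Tonelli splits off one Gaussian factor per
    dimension. *)
Lemma integral_expRN_energy n :
  (\int[lebesgue_rV n]_x (expR (- energy x))%:E =
   (Num.sqrt (2 * pi) ^+ n)%:E)%E.
Proof.
elim: n => [|n IHn].
  rewrite expr0 [LHS]integral_dirac//; last exact: measurable_EFin_expRN_energy.
  by rewrite diracT mul1e energyE big_ord0 mul0r oppr0 expR0.
have mcons : measurable_fun [set: measurableTypeR R * 'rV[R]_n] (@rV_cons R n).
  exact: measurable_rV_cons.
rewrite [LHS](ge0_integral_pushforward mcons (leb \x lebesgue_rV n)%E
  measurableT)//=; last exact: measurable_EFin_expRN_energy.
rewrite preimage_setT fubini_tonelli1//=; last first.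
  have m := measurable_EFin_expRN_energy (n:=n.+1).
  exact: (measurableT_comp m mcons).
transitivity (\int[leb]_a ((expR (- (a ^+ 2 / 2)))%:E *
    (Num.sqrt (2 * pi) ^+ n)%:E))%E.
  apply: eq_integral => a _; rewrite -IHn /fubini_F -ge0_integralZl//.
  - by apply: eq_integral => v _; rewrite energy_cons opprD expRD EFinM.
  - exact: measurable_EFin_expRN_energy.
rewrite ge0_integralZr//.
- by rewrite integral_expRN_sqr_half -EFinM exprS.
- have m : measurable_fun [set: R] (fun a : R => expR (- (a ^+ 2 / 2))).
    apply: measurableT_comp => //; apply: measurable_funN.
    by apply: measurable_funM => //; exact: exprn_measurable.
  exact/measurable_EFinP.
Qed.

Lemma integrable_expRN_energy n (c : R) : 0 < c ->
  (lebesgue_rV n).-integrable setT (fun x => (expR (- (c * energy x)))%:E).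
Proof.
move=> c0; apply/integrableP; split.
  by apply/measurable_EFinP; exact: measurable_expRN_energy.
have s0 : 0 < Num.sqrt c by rewrite sqrtr_gt0.
rewrite (eq_integral (fun x : 'rV[R]_n =>
  (expR (- energy (Num.sqrt c *: x)))%:E));
  last first.
  by move=> x _; rewrite energyZ sqr_sqrtr ?ltW// gee0_abs// lee_fin expR_ge0.
rewrite (ge0_integral_rV_scale (D := setT) (f := fun x =>
  (expR (- energy x))%:E))//.
  by rewrite integral_expRN_energy -EFinM ltry.
exact: measurable_EFin_expRN_energy.
Qed.

(** Half of the exponential absorbs the power: raise b t <= e^{b t} to the power [k] for a small
    b. *)
Lemma exprM_expRN_le (c : R) k : 0 < c ->
  exists M : R, forall t, 0 <= t -> t ^+ k * expR (- (c * t)) <=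
    M * expR (- (c / 2 * t)).
Proof.
(* This choice gives k b <= c / 2; the successor keeps the denominator nonzero at [k = 0]. *)
move=> c0; pose b := c / (2 * k.+1%:R).
have b0 : 0 < b by rewrite divr_gt0// mulr_gt0.
exists (b ^- k) => t t0.
have tb : b * t <= expR (b * t)
  by rewrite (le_trans _ (expR_ge1Dx _))// ler_wpDl.
have : (b * t) ^+ k <= expR (b * t) ^+ k
  by rewrite lerXn2r ?nnegrE ?mulr_ge0 ?expR_ge0// ltW.
rewrite exprMn -ler_pdivlMl ?exprn_gt0// -expRM_natl => tk.
apply: le_trans (_ : b ^- k * expR (k%:R * (b * t)) * expR (- (c * t)) <= _).
  by rewrite ler_wpM2r// expR_ge0.
rewrite -mulrA; apply: ler_wpM2l; first by rewrite invr_ge0 exprn_ge0// ltW.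
rewrite -expRD ler_expR.
have kb : k%:R * b <= c / 2.
  rewrite /b mulrA ler_pdivrMr ?mulr_gt0// -(natr1 k); nra.
rewrite mulrA; have := ler_wpM2r t0 kb; lra.
Qed.

Lemma integrable_exprM_expRN_energy n (c : R) k : 0 < c ->
  (lebesgue_rV n).-integrable setT
    (fun x => (energy x ^+ k * expR (- (c * energy x)))%:E).
Proof.
move=> c0; have [M hM] := exprM_expRN_le k c0.
have c20 : 0 < c / 2 by rewrite divr_gt0.
apply: (@le_integrable _ _ _ (lebesgue_rV n) _ measurableT _
  (fun x => M%:E * (expR (- (c / 2 * energy x)))%:E)%E).
- apply/measurable_EFinP; apply: measurable_funM;
  last exact: measurable_expRN_energy.
  by apply: measurable_funX; exact: measurable_energy.
- move=> x _; rewrite gee0_abs ?lee_fin ?mulr_ge0 ?exprn_ge0 ?energy_ge0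
  ?expR_ge0//.
  exact: le_trans (hM _ (energy_ge0 x)) (ler_norm _).
- by apply: integrableZl => //; exact: integrable_expRN_energy.
Qed.
End energy.

(** * A recurrence for the Gamma integral *)

Section gamma.
Context {R : realType}.
Local Notation mu := (@lebesgue_measure R).

Lemma continuous_powR_gt0 (m x : R) :
  0 < x -> {for x, continuous (powR (R:=R) ^~ m)}.
Proof.
move=> x0; apply: differentiable_continuous; apply/derivable1_diffP.
by have [] := is_derive1_powR m x0.
Qed.

Lemma measurable_powR_expRN (m : R) (D : set R) :
  measurable_fun D (fun t => (t `^ m * expR (- t))%:E).
Proof.
apply/measurable_EFinP/measurable_funTS; apply: measurable_funM.
  exact: measurable_powR.
by apply: measurableT_comp => //.
Qed.

Lemma powR_expRN_ge0 (m t : R) : 0 <= t `^ m * expR (- t).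
Proof. by rewrite mulr_ge0 ?powR_ge0 ?expR_ge0. Qed.

(** Integration by parts of t^m against -e^{-t}. Each boundary term stands on the side where it is
    added, so that no subtraction of extended reals remains when a tends to 0 and b to infinity. *)
Lemma integral_powR_expRN_parts (m a b : R) : 0 <= m -> 0 < a -> a < b ->
  (\int[mu]_(t in `[a, b]) (t `^ m * expR (- t))%:E + (b `^ m * expR (- b))%:E =
   \int[mu]_(t in `[a, b]) (m * (t `^ (m - 1) * expR (- t)))%:E
   + (a `^ m * expR (- a))%:E)%E.
Proof.
move=> m0 a0 ab.
have pos x : a <= x -> 0 < x by exact: lt_le_trans.
have dE (x : R) : is_derive x 1 (fun t : R => - expR (- t)) (expR (- x)).
  by apply: is_derive_eq; rewrite mulrN1 opprK.
have cE : continuous (fun t : R => - expR (- t)).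
  move=> x; apply: differentiable_continuous; apply/derivable1_diffP.
  by have [] := dE x.
have cE' : continuous (fun t : R => expR (- t)).
  move=> x; apply: continuous_comp; first exact: opp_continuous.
  exact: continuous_expR.
have := @integration_by_parts R (powR (R:=R) ^~ m) (fun t => - expR (- t))
  (fun t => m * t `^ (m - 1)) (fun t => expR (- t)) a b ab.
have inpos x : x \in `[a, b]%classic -> 0 < x.
  by rewrite inE/= in_itv/= => /andP[/pos].
move=> ->.
- have -> : (\int[mu]_(x in `[a, b]) (m * x `^ (m - 1) * - expR (- x))%:E =
      - \int[mu]_(x in `[a, b]) (m * (x `^ (m - 1) * expR (- x)))%:E)%E.
    rewrite -integral_ge0N; last first.
      by move=> t _; rewrite lee_fin mulr_ge0// powR_expRN_ge0.
    by apply: eq_integral => t _; rewrite mulrN EFinN mulrA.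
  rewrite oppeK addeAC -EFinD addeC; congr (_ + _%:E)%E; ring.
- apply: continuous_in_subspaceT => x /inpos x0; apply: cvgM;
  first exact: cvg_cst.
  exact: continuous_powR_gt0.
- split.
  + by move=> x; rewrite in_itv/= => /andP[/ltW/pos x0 _];
    have [] := is_derive1_powR m x0.
  + by apply: cvg_at_right_filter; exact: continuous_powR_gt0.
  + by apply: cvg_at_left_filter; apply: continuous_powR_gt0;
    exact: lt_trans ab.
- move=> x; rewrite in_itv/= => /andP[/ltW/pos x0 _].
  by rewrite derive1E; have [_ ->] := is_derive1_powR m x0.
- exact: continuous_subspaceT.
- split.
  + by move=> x _; have [] := dE x.
  + by apply: cvg_at_right_filter; exact: cE.
  + by apply: cvg_at_left_filter; exact: cE.
- by move=> x _; rewrite derive1E; have [_ ->] := dE x.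
Qed.

Lemma cvg_powR_expRN (m : R) : t `^ m * expR (- t) @[t --> +oo] --> 0.
Proof.
(* A natural exponent above [m]: for t >= 1, t^m is at most t^k, to which [exprM_expRN_le]
   applies. *)
pose k := Num.bound `|m|.
have [M hM] := exprM_expRN_le k (@ltr01 R).
apply: (@squeeze_cvgr _ _ _ _ (cst 0) (fun t => M * expR (- (2^-1 * t)))).
- near=> t; rewrite powR_expRN_ge0/=.
  have t1 : 1 <= t by near: t; exact: nbhs_pinfty_ge.
  have := hM t (le_trans ler01 t1); rewrite !mul1r; apply: le_trans.
  rewrite ler_wpM2r ?expR_ge0// -powR_mulrn ?(le_trans ler01)//.
  by apply: ler_powR => //; exact: ltW (le_lt_trans (ler_norm m) (archi_boundP
    (normr_ge0 m))).
- exact: cvg_cst.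
- rewrite -[X in _ --> X](mulr0 M); apply: cvgM; first exact: cvg_cst.
  apply: (cvg_comp (fun t : R => 2^-1 * t) (fun t => expR (- t)));
    last exact: cvgr_expR.
  have h : (0 : R) < 2^-1 by [].
  exact: (gt0_cvgMry h (@cvg_id _ _)).
Unshelve. all: by end_near. Qed.

(** The functional equation Gamma(m + 1) = m Gamma(m), as a limit of integrations by parts. It is
    stated in the extended reals because finiteness of the integrals is obtained only later, in
    [volume_Gamma]. *)
Lemma integral_powR_expRN_rec (m : R) : 0 < m ->
  (\int[mu]_(t in `]0%R, +oo[) (t `^ m * expR (- t))%:E =
   m%:E * \int[mu]_(t in `]0%R, +oo[) (t `^ (m - 1) * expR (- t))%:E)%E.
Proof.
move=> m0.
(* The shift by 2 makes [a k < 1 < b k] strict already at [k = 0]. *)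
pose a (k : nat) : R := k.+2%:R^-1.
pose b (k : nat) : R := k.+2%:R.
pose F k : set R := `[a k, b k]%classic.
have a0 k : 0 < a k by rewrite invr_gt0.
have ab k : a k < b k.
  by rewrite (@lt_trans _ _ 1)// ?invf_lt1 ?ltr1n.
have UF : \bigcup_k F k = `]0, +oo[%classic.
  apply/seteqP; split => [x [k _]|x]; rewrite /F/= !in_itv/= ?andbT.
    by move=> /andP[ax _]; exact: lt_le_trans (a0 k) ax.
  move=> x0; pose k := Num.bound `|Num.max x x^-1|.
  have mk : Num.max x x^-1 < k.+2%:R.
    rewrite (@lt_trans _ _ k%:R)// ?ltr_nat; last by [].
    by rewrite (le_lt_trans (ler_norm _))// archi_boundP.
  move: mk; rewrite gt_max => /andP[xk x'k].
  exists k => //; rewrite /= in_itv/= (ltW xk) andbT /a.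
  by rewrite invf_ple ?posrE// ltW.
have ndF : {homo F : n m / (n <= m)%N >-> (n <= m)%O}.
  move=> i j ij; rewrite subsetEset; apply: subset_itv; rewrite bnd_simp.
    by rewrite lef_pV2 ?posrE// ler_nat !ltnS.
  by rewrite ler_nat !ltnS.
have lim p : (\int[mu]_(t in F i) (t `^ p * expR (- t))%:E @[i --> \oo] -->
    \int[mu]_(t in `]0%R, +oo[) (t `^ p * expR (- t))%:E)%E.
  rewrite -UF; apply: ge0_nondecreasing_set_cvg_integral => //.
  - by move=> i; exact: measurable_itv.
  - by move=> i; exact: measurable_powR_expRN.
  - by move=> i x _; rewrite lee_fin powR_expRN_ge0.
have cvg_b : b k @[k --> \oo] --> +oo.
  by have := @cvgr_idn R; rewrite -(cvg_shiftn 2);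
    under eq_fun do rewrite addn2.
have L1 : (b k `^ m * expR (- b k))%:E @[k --> \oo] --> 0%E.
  apply: cvg_EFin; first exact: nearW.
  exact: (cvg_comp _ _ cvg_b (cvg_powR_expRN m)).
have L2 : (a k `^ m * expR (- a k))%:E @[k --> \oo] --> 0%E.
  apply: cvg_EFin; first exact: nearW.
  apply: (@squeeze_cvgr _ _ _ _ (cst 0) (fun k => a k `^ m)).
  - apply: nearW => k; rewrite powR_expRN_ge0/= ler_piMr ?powR_ge0//.
    by rewrite -expR0 ler_expR oppr_le0 ltW.
  - exact: cvg_cst.
  - apply: (iffLR (cvg_at_rightP _ _ _) (powR_cvg0 m0)); split => //.
    have a_gt0 : \forall k \near \oo, 0 < b k by apply: nearW => k;
      rewrite ltr0n.
    exact: (iffRL (gtr0_cvgV0 a_gt0)).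
have f0 : (0%E : \bar R) \is a fin_num by [].
have fm : m%:E \is a fin_num by [].
have A1 := cvgeD (fin_num_adde_defl _ f0) (lim m) L1.
have A2 := cvgeD (fin_num_adde_defl _ f0) (cvgeZl fm (lim (m - 1))) L2.
rewrite !adde0 in A1 A2.
have H := @ereal_hausdorff R.
rewrite -(cvg_lim H (A1 _)) -(cvg_lim H (A2 _)); congr (limn _).
apply/funext => k /=; rewrite integral_powR_expRN_parts ?ltW//
  -ge0_integralZl//.
- exact: measurable_itv.
- exact: measurable_powR_expRN.
- by move=> x _; rewrite lee_fin powR_expRN_ge0.
- by rewrite lee_fin ltW.
Qed.

End gamma.

(** * The volume of a ball *)

Section layer_cake.
Context {R : realType}.
Local Notation leb :=
  (lebesgue_measure : {sigma_finite_measure set (measurableTypeR R) -> \bar R}).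

Definition energy_ball n (s : R) : set 'rV[R]_n := [set x | energy x < s].
Arguments energy_ball : clear implicits.

Lemma measurable_energy_ball n (s : R) : measurable (energy_ball n s).
Proof.
rewrite (_ : energy_ball n s = @energy R n @^-1` `]-oo, s[); last first.
  by apply/seteqP; split => x /=; rewrite in_itv.
rewrite -[X in measurable X]setTI; apply: measurable_energy => //.
Qed.

(** The energy is quadratic, so dividing by sqrt s maps this ball onto the unit one. *)
Lemma measure_energy_ball n (s : R) : 0 < s ->
  lebesgue_rV n (energy_ball n s) =
  ((s `^ (n%:R / 2))%:E * lebesgue_rV n (energy_ball n 1))%E.
Proof.
move=> s0; pose c := (Num.sqrt s)^-1.
have c0 : 0 < c by rewrite invr_gt0 sqrtr_gt0.
have -> : energy_ball n s = (fun x => c *: x) @^-1` energy_ball n 1.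
  apply/seteqP; split => x /=;
    rewrite /energy_ball/= energyZ exprVn sqr_sqrtr ?ltW//;
  by rewrite ltr_pdivrMl// mulr1.
rewrite lebesgue_rV_scale//; last exact: measurable_energy_ball.
congr (_%:E * _)%E.
by rewrite /c exprVn invrK mulrC powRrM powR12_sqrt ?ltW// powR_mulrn//
  sqrtr_ge0.
Qed.

Lemma integral_expRN_itvoy (a : R) :
  (\int[leb]_(s in `]a, +oo[) (expR (- s))%:E = (expR (- a))%:E)%E.
Proof.
have mE (D : set R) : measurable_fun D (fun s : R => (expR (- s))%:E).
  by apply/measurable_EFinP/measurable_funTS; apply: measurableT_comp.
rewrite integral_itv_obnd_cbnd//.
have dE (x : R) : is_derive x 1 (fun t : R => - expR (- t)) (expR (- x)).
  by apply: is_derive_eq; rewrite mulrN1 opprK.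
have cE : continuous (fun t : R => - expR (- t)).
  move=> x; apply: differentiable_continuous; apply/derivable1_diffP.
  by have [] := dE x.
have cE' : continuous (fun t : R => expR (- t)).
  move=> x; apply: continuous_comp; first exact: opp_continuous.
  exact: continuous_expR.
rewrite (@ge0_continuous_FTC2y _ _ (fun t => - expR (- t)) _ 0)//.
- by rewrite -EFinB sub0r opprK.
- exact: continuous_subspaceT.
- by rewrite -[X in _ --> X]oppr0; apply: cvgN; exact: cvgr_expR.
- by apply: cvg_at_right_filter; exact: cE.
- by move=> x _; rewrite derive1E; have [_ ->] := dE x.
Qed.

(** Layer cake: Tonelli on the region T(x) < s. Integrating over s first gives the Gaussian
    integral; integrating over x first gives the volume of {T < s}, which is a multiple of
    s^{n/2}. *)
Lemma sqrt2pi_exprn_volume n :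
  ((Num.sqrt (2 * pi) ^+ n)%:E = lebesgue_rV n (energy_ball n 1) *
   \int[leb]_(s in `]0%R, +oo[) (s `^ (n%:R / 2) * expR (- s))%:E)%E.
Proof.
pose f (z : 'rV[R]_n * measurableTypeR R) : \bar R :=
  (if energy z.1 < z.2 then expR (- z.2) else 0)%:E.
have f0 z : (0 <= f z)%E by rewrite lee_fin; case: ifP => // _; exact: expR_ge0.
have mlt : measurable_fun [set: 'rV[R]_n * measurableTypeR R]
    (fun z : 'rV[R]_n * measurableTypeR R => energy z.1 < z.2).
  apply: measurable_fun_ltr; last exact: measurable_snd.
  have me := @measurable_energy R n.
  exact: (measurableT_comp me measurable_fst).
have mf : measurable_fun [set: 'rV[R]_n * measurableTypeR R] f.
  apply/measurable_EFinP; apply: measurable_fun_ifT => //.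
  apply: measurableT_comp => //; apply: measurable_funN; exact: measurable_snd.
have := fubini_tonelli (m1 := lebesgue_rV n) (m2 := leb) f mf f0.
rewrite -integral_expRN_energy => E.
transitivity (\int[lebesgue_rV n]_x \int[leb]_s f (x, s))%E.
  (* e^{-T(x)} is the integral of e^{-s} over s > T(x) *)
  apply: eq_integral => x _; rewrite -integral_expRN_itvoy integral_mkcond.
  apply: eq_integral => s _; rewrite /f patchE mem_setE/= in_itv/= andbT.
  by case: ifP.
rewrite E -[RHS]ge0_integralZl//; last 2 first.
- exact: measurable_powR_expRN.
- by move=> s _; rewrite lee_fin powR_expRN_ge0.
rewrite [RHS]integral_mkcond; apply: eq_integral => s _.
rewrite patchE mem_setE/= in_itv/= andbT.
have [s0|s0] := ltP 0 s; last first.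
  rewrite (eq_integral (fun=> 0%E)) ?integral0// => x _.
  by rewrite /f/= ltNge (le_trans s0 (energy_ge0 x)).
rewrite EFinM muleA [(_ * (s `^ _)%:E)%E]muleC -measure_energy_ball//.
rewrite muleC -integral_cst; last exact: measurable_energy_ball.
rewrite [RHS]integral_mkcond; apply: eq_integral => x _.
rewrite /f/= patchE (_ : x \in energy_ball n s = (energy x < s)).
  by case: ifP.
by apply/idP/idP; rewrite inE.
Qed.

End layer_cake.
Arguments energy_ball {R} n s _.

Section volume.
Context {R : realType}.

(** All claims are extracted from one identity: a product of nonnegative extended reals equals a
    positive real, hence no factor can be infinite or zero. *)
Lemma volume_Gamma n : (0 < n)%N -> exists V : R,
  [/\ lebesgue_rV n (energy_ball n 1) = V%:E, 0 <= V, 0 < Gamma (n%:R / 2 : R) &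
      Num.sqrt (2 * pi) ^+ n = V * (n%:R / 2 * Gamma (n%:R / 2))].
Proof.
move=> n0; have m0 : 0 < n%:R / 2 :> R by rewrite divr_gt0// ltr0n.
have := @sqrt2pi_exprn_volume R n.
rewrite integral_powR_expRN_rec// /Gamma /Rintegral.
set c := (Num.sqrt (2 * pi) ^+ n); set v := lebesgue_rV n _.
set G := (\int[_]_(_ in _) _)%E.
have c0 : 0 < c by rewrite exprn_gt0// sqrtr_gt0 mulr_gt0// pi_gt0.
have v0 : (0 <= v)%E by exact: measure_ge0.
have G0 : (0 <= G)%E by apply: integral_ge0 => x _;
  rewrite lee_fin powR_expRN_ge0.
case: G G0 => [G||]// G0.
  rewrite -EFinM /=; case: v v0 => [v||]// v0.
    rewrite -EFinM => -[cE].
    exists v; split=> //; rewrite lt_neqAle -lee_fin G0 andbT.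
    by apply: contraTneq c0 => G00; rewrite cE -G00 !mulr0 ltxx.
  have [->|G1] := eqVneq (n%:R / 2 * G) 0.
    by rewrite mule0 => -[c00]; rewrite c00 ltxx in c0.
  by rewrite gt0_mulye// lte_fin lt_neqAle eq_sym G1/= mulr_ge0// ltW.
rewrite gt0_muley ?lte_fin//; case: v v0 => [v||]// v0.
  have [->|v1] := eqVneq v 0.
    by rewrite mul0e => -[c00]; rewrite c00 ltxx in c0.
  by rewrite gt0_muley// lte_fin lt_neqAle eq_sym v1.
Qed.

End volume.

(** * Shells of a star-shaped set *)

Section star_shaped.
Context {R : realType} (n : nat) (S : set 'rV[R]_n) (a : R).
Hypothesis mS : measurable S.
Hypothesis starS : forall x (t : R), S x -> 0 <= t <= 1 -> S (t *: x).
Hypothesis a_gt0 : 0 < a.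

(** The set S \ cS of the header, with c = e^{-a}. *)
Let E : set 'rV[R]_n := S `\` [set x | S (expR a *: x)].

Let mE : measurable E.
Proof.
apply: measurableD => //; rewrite -[X in measurable X]setTI.
exact: measurable_rV_scale.
Qed.

(** Dilating x by e^a multiplies T by e^{2a}, hence the factor 2 and the passage from one shell to
    the next. In the header's numbering k = - j - 1. *)
Let shell (j : int) : set 'rV[R]_n :=
  energy_ball n (expR (2 * a * (j + 1)%:~R)) `\` energy_ball n (expR (2 * a *
    j%:~R)).

Let mshell j : measurable (shell j).
Proof. by apply: measurableD; exact: measurable_energy_ball. Qed.

Let shellP j x : shell j x <->
  (expR (2 * a * j%:~R) <= energy x < expR (2 * a * (j + 1)%:~R)).
Proof.
rewrite /shell /energy_ball/=; split=> [[-> /negP]|/andP[xj ->]].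
  by rewrite -leNgt andbT.
by split=> //; apply/negP; rewrite -leNgt.
Qed.

Let energy_E_gt0 x : E x -> 0 < energy x.
Proof.
move=> [Sx nSx]; rewrite lt_neqAle energy_ge0 andbT eq_sym.
by apply/eqP => /energy_eq0 x0; apply: nSx; move: Sx; rewrite /= x0 scaler0.
Qed.

Let shell_exists x : 0 < energy x -> exists j, shell j x.
Proof.
move=> x0; exists (Num.floor (ln (energy x) / (2 * a))); apply/shellP.
have a20 : 0 < 2 * a by rewrite mulr_gt0.
have := floor_itv (ln (energy x) / (2 * a)); move: (Num.floor _) => k.
rewrite ler_pdivlMr// ltr_pdivrMr// => /andP[h1 h2].
by rewrite -[energy x]lnK ?posrE// ler_expR ltr_expR ![2 * a * _]mulrC h1 h2.
Qed.

Let shell_inj i j x : shell i x -> shell j x -> i = j.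
Proof.
move=> /shellP/andP[i1 i2] /shellP/andP[j1 j2].
have a20 : 0 < 2 * a by rewrite mulr_gt0.
have := le_lt_trans i1 j2; rewrite ltr_expR ltr_pM2l// ltr_int.
have := le_lt_trans j1 i2; rewrite ltr_expR ltr_pM2l// ltr_int.
by rewrite !ltzD1 => h1 h2; apply/eqP; rewrite eq_le h1 h2.
Qed.

(* The dilation by dil j maps shell (-1) = {e^{-2a} <= T < 1} onto shell j. *)
Let dil (j : int) : R := expR (a * (j + 1)%:~R).

Let piece (j : int) : set 'rV[R]_n := E `&` shell j.

Let scaled_piece (j : int) : set 'rV[R]_n := (fun x =>
  dil j *: x) @^-1` piece j.

Let mpiece j : measurable (piece j). Proof. exact: measurableI. Qed.

Let mscaled_piece j : measurable (scaled_piece j).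
Proof. by rewrite -[X in measurable X]setTI; exact: measurable_rV_scale. Qed.

Let star_expR (x : 'rV[R]_n) (t u : R) :
  t <= u -> S (expR u *: x) -> S (expR t *: x).
Proof.
move=> tu Su; rewrite -(subrK u t) expRD -scalerA; apply: starS => //.
by rewrite expR_ge0/= -expR0 ler_expR subr_le0.
Qed.

(** If x lay in the pieces k < l, then e^{a(l+1)} x would be in S, hence so would e^{a(k+2)} x since
    S is star-shaped; but [dil k *: x] is outside e^{-a} S. *)
Let scaled_piece_disjoint i j x :
  scaled_piece i x -> scaled_piece j x -> i = j.
Proof.
suff H k l : k < l -> scaled_piece k x -> scaled_piece l x -> False.
  move=> Hi Hj; case: (ltgtP i j) => // ij.
    by case: (H _ _ ij Hi Hj).
  by case: (H _ _ ij Hj Hi).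
move=> kl [[_ nS] _] [[Sl _] _]; apply: nS; rewrite /= scalerA -expRD.
apply: star_expR Sl; rewrite -[X in X + _]mulr1 -mulrDr ler_pM2l//.
by rewrite -[1]/(1%:~R) -intrD ler_int addrC lerD2r lezD1.
Qed.

Let scaled_piece_shell j : scaled_piece j `<=` shell (-1).
Proof.
move=> x [_ /shellP]; rewrite energyZ /dil -expRM_natl => /andP[h1 h2].
apply/shellP; rewrite addNr mulr0 expR0.
set c := 2 * (a * (j + 1)%:~R) in h1 h2.
have c0 : 0 < expR c by exact: expR_gt0.
rewrite -(ler_pM2l c0) -(ltr_pM2l c0) -expRD mulr1; apply/andP; split.
  apply: le_trans h1; rewrite ler_expR /c intrD; lra.
by apply: lt_le_trans h2 _; rewrite ler_expR /c mulrA.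
Qed.

Let measurable_powR_energy (D : set 'rV[R]_n) (p : R) :
  measurable_fun D (fun x => (energy x `^ p)%:E).
Proof.
apply/measurable_EFinP/measurable_funTS.
have me := @measurable_energy R n.
exact: (measurableT_comp (measurable_powR p) me).
Qed.

(** On shell j the weight is at most e^{-naj}, and rescaling multiplies the volume by e^{-na(j+1)};
    the quotient e^{na} is the same for all j. *)
Let integral_piece_le j :
  (\int[lebesgue_rV n]_(x in piece j) (energy x `^ (- (n%:R / 2)))%:E <=
   (expR (n%:R * a))%:E * lebesgue_rV n (scaled_piece j))%E.
Proof.
apply: (@le_trans _ _ (\int[lebesgue_rV n]_(x in piece j)
    (expR (- (n%:R * a * j%:~R)))%:E)%E).
  apply: ge0_le_integral => //.
  - by move=> x _; rewrite lee_fin powR_ge0.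
  - move=> x [Ex /shellP/andP[xj _]];
    rewrite lee_fin /powR gt_eqF ?energy_E_gt0//.
    rewrite ler_expR mulNr lerN2.
    have : 2 * a * j%:~R <= ln (energy x).
      by rewrite -ler_expR lnK// posrE energy_E_gt0.
    have : 0 <= n%:R / 2 :> R by rewrite divr_ge0.
    move=> n2 /(ler_wpM2l n2); apply: le_trans; lra.
rewrite [leLHS]integral_cst//.
rewrite /scaled_piece lebesgue_rV_scale ?expR_gt0//.
rewrite muleA -EFinM /dil -expRM_natl -expRN -expRD intrD.
by apply: lee_wpmul2r; [exact: measure_ge0|rewrite lee_fin ler_expR; lra].
Qed.

(** The rescaled pieces are disjoint inside one shell of volume V(1 - e^{-na}); the common factor
    e^{na} then yields the bound. *)
Lemma integral_star_shell (V : R) : lebesgue_rV n (energy_ball n 1) = V%:E ->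
  (\int[lebesgue_rV n]_(x in S `\` [set x | S (expR a *: x)])
     (energy x `^ (- (n%:R / 2)))%:E <= (V * (expR (n%:R * a) - 1))%:E)%E.
Proof.
move=> VE.
(* Countable additivity concerns sequences over [nat], so the integers are enumerated by their
   codes; a number that codes nothing gets the empty set. *)
pose F (G : int -> set 'rV[R]_n) (m :
  nat) := oapp G set0 (pickle_inv (T := int) m).
have trivF G : (forall i j x, G i x -> G j x -> i = j) -> trivIset setT (F G).
  move=> Ginj; apply/trivIsetP => i j _ _; apply: contraNP.
  rewrite /F.
  case Ei : (pickle_inv i) => [k|]; last by rewrite /= set0I => /(_ erefl).
  case Ej : (pickle_inv j) => [l|]; last by rewrite /= setI0 => /(_ erefl).
  move=> /eqP/set0P[x [/= Gk Gl]]; have kl := Ginj _ _ _ Gk Gl.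
  have := @pickle_invK int i; have := @pickle_invK int j.
  by rewrite Ei Ej kl /= => <- <-.
have mF G : (forall i, measurable (G i)) -> forall m, measurable (F G m).
  move=> mG m; rewrite /F; case: pickle_inv => [k|] /=;
    [exact: mG|exact: measurable0].
have EF : E = \bigcup_m F piece m.
  apply/seteqP; split => [x Ex|x [m _]]; last first.
    by rewrite /F; case: pickle_inv => [k [Ex _]|].
  have [j xj] := shell_exists (energy_E_gt0 Ex).
  by exists (pickle j) => //; rewrite /F pickleK_inv.
rewrite -/E EF ge0_integral_bigcup//; last 3 first.
- exact: mF.
- by move=> x _; rewrite lee_fin powR_ge0.
- by apply: trivF => i j x [_ xi] [_ xj]; exact: shell_inj xi xj.
apply: (@le_trans _ _ (\sum_(i <oo) (expR (n%:R * a))%:E *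
    lebesgue_rV n (F scaled_piece i))%E).
  apply: lee_nneseries => [i _ _|i _].
    by apply: integral_ge0 => x _; rewrite lee_fin powR_ge0.
  rewrite /F; case: pickle_inv => /= [j|]; first exact: integral_piece_le.
  by rewrite integral_set0 measure0 mule0.
rewrite nneseriesZl; last by move=> i _; exact: measure_ge0.
have -> : (\sum_(i <oo) lebesgue_rV n (F scaled_piece i) =
    lebesgue_rV n (\bigcup_i F scaled_piece i))%E.
  rewrite measure_bigcup; last 2 first.
  - by move=> i _; exact: mF.
  - exact: trivF.
  by apply: eq_eseriesl => i; rewrite in_setT.
apply: (@le_trans _ _ ((expR (n%:R * a))%:E * lebesgue_rV n (shell (-1)))%E).
  apply: lee_wpmul2l; first by rewrite lee_fin expR_ge0.
  apply: le_measure; rewrite ?inE//.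
    by apply: bigcup_measurable => i _; exact: mF.
  move=> x [m _]; rewrite /F; case: pickle_inv => [j|//] /=;
    exact: scaled_piece_shell.
rewrite /shell addNr mulr0 expR0 measureD; last 3 first.
- exact: measurable_energy_ball.
- exact: measurable_energy_ball.
- by rewrite /= VE ltry.
have -> : energy_ball n 1 `&` energy_ball n (expR (2 * a * (-1)%:~R)) =
    energy_ball n (expR (2 * a * (-1)%:~R)).
  apply/setIidPr => x; rewrite /energy_ball/= => xa; apply: lt_le_trans xa _.
  by rewrite -[leRHS]expR0 ler_expR mulrN1 oppr_le0 mulr_ge0// ltW.
rewrite [X in (_ * (_ - X))%E]measure_energy_ball ?expR_gt0// VE
  [X in (_ * (X - _))%E]VE.
change (expR (n%:R * a) * (V - expR (2 * a * (-1)%:~R) `^ (n%:R / 2) * V) <=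
  V * (expR (n%:R * a) - 1)).
rewrite -expRM.
have -> : 2 * a * (-1)%:~R * (n%:R / 2) = - (n%:R * a) :> R.
  by rewrite mulrN1; field.
by rewrite mulrBr mulrA -expRD subrr expR0 mul1r mulrBr mulr1 mulrC.
Qed.

End star_shaped.

(** * Scalar inequalities *)

Section scalar.
Context {R : realType}.

Lemma le_expR_subr1 (x : R) : x <= expR (x - 1).
Proof. by have := expR_ge1Dx (x - 1); lra. Qed.

(* The hypothesis on v says that it is a critical point of t^m e^{-t} (t - a).
   The logarithm being concave, it suffices to bound both t / v and
   (t - a) / (v - a) by x <= e^{x - 1}: the exponents then add up to t - v. *)
Lemma powR_expRN_affine_le (m a v c t : R) :
  0 <= m -> 0 < v -> (v - m) * (v - a) = v -> 0 < c * (v - a) -> 0 < t ->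
  t `^ m * (expR (- t) * (c * (t - a))) <=
    v `^ m * (expR (- v) * (c * (v - a))).
Proof.
move=> m0 v0 vE cv t0.
have v_neq0 : v != 0 by rewrite gt_eqF.
have va_neq0 : v - a != 0.
  by apply: contraTneq cv => ->; rewrite mulr0 ltxx.
have h1 : t `^ m <= v `^ m * expR (m * (t / v - 1)).
  rewrite -[X in X `^ _ <= _](divfK v_neq0) mulrC powRM ?divr_ge0 ?(ltW t0)
    ?(ltW v0)//.
  rewrite ler_wpM2l ?powR_ge0// [m * _]mulrC expRM.
  by apply: ge0_ler_powR; rewrite ?nnegrE ?divr_ge0 ?expR_ge0 ?le_expR_subr1
    ?(ltW t0) ?(ltW v0).
have h2 : c * (t - a) <= c * (v - a) * expR ((t - a) / (v - a) - 1).
  have -> : c * (t - a) = c * (v - a) * ((t - a) / (v - a)) by field.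
  by rewrite ler_wpM2l ?le_expR_subr1// ltW.
have -> : v `^ m * (expR (- v) * (c * (v - a))) =
  v `^ m * expR (m * (t / v - 1)) *
    (expR (- t) * (c * (v - a) * expR ((t - a) / (v - a) - 1))).
  have -> : - v = m * (t / v - 1) + (- t + ((t - a) / (v - a) - 1)).
    (* The critical point equation replaces 1 / (v - a) by (v - m) / v; together with m / v the
       coefficients of t - v sum to 1. *)
    have -> : (t - a) / (v - a) - 1 = (t - v) * ((v - m) / v).
      have -> : (v - m) / v = (v - a)^-1 by apply: (mulIf va_neq0);
        rewrite mulVf// mulrAC vE divff.
      by field.
    by field.
  by rewrite !expRD; ring.
(* [h1] and [h2] can be multiplied only when the left factors are nonnegative; otherwise 0 separates
   the two sides. *)
have [tc|tc] := leP 0 (c * (t - a)).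
  apply: ler_pM => //; [exact: powR_ge0|by rewrite mulr_ge0 ?expR_ge0|].
  by rewrite ler_wpM2l ?expR_ge0.
apply: (@le_trans _ _ 0).
  by rewrite mulr_ge0_le0 ?powR_ge0// mulr_ge0_le0 ?expR_ge0// ltW.
rewrite mulr_ge0//; first by rewrite mulr_ge0 ?powR_ge0 ?expR_ge0.
by rewrite mulr_ge0 ?expR_ge0// mulr_ge0 ?expR_ge0// ltW.
Qed.

Lemma Bu_ge0 n : 0 < Gamma (n%:R / 2 : R) -> 0 <= Bu n :> R.
Proof.
move=> G0; rewrite /Bu mulr_ge0// ?divr_ge0 ?addr_ge0 ?sqrtr_ge0//.
  by rewrite mulr_ge0 ?powR_ge0 ?expR_ge0.
exact: ltW.
Qed.

Lemma sqr_sqrt2n n : Num.sqrt (2 * n%:R) ^+ 2 = 2 * n%:R :> R.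
Proof. by rewrite sqr_sqrtr// mulr_ge0. Qed.

(** With m = n/2 and a = m - 1 the critical point equation reads (v - m)^2 = m; [u_ n] is its larger
    root. *)
Lemma powR_expRN_le_Bu n (t : R) : (0 < n)%N -> 0 < Gamma (n%:R / 2 :
  R) -> 0 < t ->
  t `^ (n%:R / 2) * (expR (- t) * (t - (n%:R / 2 - 1))) <=
  Bu n * Gamma (n%:R / 2 : R).
Proof.
move=> n0 G0 t0.
have s2 := sqr_sqrt2n n; have s0 :
  0 <= Num.sqrt (2 * n%:R) :> R by exact: sqrtr_ge0.
have np : 0 < n%:R :> R by rewrite ltr0n.
have := @powR_expRN_affine_le (n%:R / 2) (n%:R / 2 - 1) (u_ n) 1 t.
rewrite !mul1r => H; apply: le_trans (H _ _ _ _ _) _ => //.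
- by rewrite /u_ divr_gt0// ltr_wpDr.
- by rewrite /u_; lra.
- by rewrite /u_; lra.
rewrite /Bu -!mulrA mulVf ?gt_eqF// /u_; lra.
Qed.

(** For n <= 2 the affine factor is nonnegative. For n > 2 the smaller root [l_ n] makes it
    negative, so the maximum principle applies with c = -1. *)
Lemma Bl_le_powR_expRN n (t : R) : (0 < n)%N -> 0 < Gamma (n%:R / 2 :
  R) -> 0 < t ->
  Bl n * Gamma (n%:R / 2 : R) <=
  t `^ (n%:R / 2) * (expR (- t) * (t - (n%:R / 2 - 1))).
Proof.
move=> n0 G0 t0; rewrite /Bl; case: leqP => n2.
  rewrite mul0r !mulr_ge0 ?powR_ge0 ?expR_ge0//.
  have : n%:R <= 2 :> R by rewrite (ler_nat _ n 2).
  lra.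
have s2 := sqr_sqrt2n n; have s0 :
  0 <= Num.sqrt (2 * n%:R) :> R by exact: sqrtr_ge0.
have np : 2 < n%:R :> R by rewrite (ltr_nat _ 2).
have s_gt2 : 2 < Num.sqrt (2 * n%:R) :> R.
  rewrite ltNge; apply/negP => s_le2.
  by have := ler_pM s0 s0 s_le2 s_le2; rewrite -expr2 s2; lra.
have s_ltn : Num.sqrt (2 * n%:R) < n%:R :> R.
  rewrite ltNge; apply/negP => n_les.
  have n_ge0 : 0 <= n%:R :> R by [].
  by have := ler_pM n_ge0 n_ge0 n_les n_les; rewrite -[leRHS]expr2 s2; nra.
have H : t `^ (n%:R / 2) * (expR (- t) * (-1 * (t - (n%:R / 2 - 1)))) <=
    l_ n `^ (n%:R / 2) * (expR (- l_ n) * (-1 * (l_ n - (n%:R / 2 - 1)))).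
  apply: powR_expRN_affine_le => //; first by rewrite /l_ divr_gt0// subr_gt0.
    by rewrite /l_; lra.
  by rewrite /l_; lra.
rewrite -lerN2; apply: le_trans (le_trans _ H) _;
  first by rewrite !mulN1r !mulrN.
rewrite -!mulrA mulVf ?gt_eqF// mulr1 /l_; lra.
Qed.

Lemma Bl_le0 n : 0 < Gamma (n%:R / 2 : R) -> Bl n <= 0 :> R.
Proof.
move=> G0; rewrite /Bl; case: leqP => // n2.
have s2 := sqr_sqrt2n n; have s0 :
  0 <= Num.sqrt (2 * n%:R) :> R by exact: sqrtr_ge0.
have np : 2 < n%:R :> R by rewrite (ltr_nat _ 2).
have s_gt2 : 2 < Num.sqrt (2 * n%:R) :> R.
  rewrite ltNge; apply/negP => s_le2.
  by have := ler_pM s0 s0 s_le2 s_le2; rewrite -expr2 s2; lra.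
rewrite mulNr oppr_le0 mulr_ge0//; first lra.
by rewrite !mulr_ge0 ?powR_ge0 ?expR_ge0// invr_ge0 ltW.
Qed.

(** The derivative is also the limit of the left difference quotients, which are nonpositive
    here. *)
Lemma derive_le0_left (f : R -> R) (g d : R) : 0 < g -> is_derive g 1 f d ->
  (forall y, 0 < y < g -> f g <= f y) -> d <= 0.
Proof.
move=> g0 [df <-] fle; have /cvg_dnbhs_at_left fd := df.
rewrite /derive -(cvg_lim _ fd)//; apply: limr_le; first by apply/cvg_ex;
  eexists; exact: fd.
near=> h.
have h0 : h < 0 by near: h; exact: nbhs_left_lt.
have gh : - g < h by near: h; apply: nbhs_left_gt; rewrite oppr_lt0.
rewrite /= -[_ *: _]/(_ * _) nmulr_rle0 ?invr_lt0// subr_ge0.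
by rewrite -[h *: 1]/(h * 1) mulr1; apply: fle; lra.
Unshelve. all: by end_near. Qed.

(** The hypothesis says that f(y) + K g^m y^{-m}, for 0 < y <= g, is least at y = g; its derivative
    there is d - K m / g. *)
Lemma is_derive_le_powR (f : R -> R) (g d m K : R) :
  0 < g -> is_derive g 1 f d ->
  (forall y, 0 < y < g -> f g - f y <= K * (g `^ m * y `^ (- m) - 1)) ->
  d <= K * (m / g).
Proof.
move=> g0 df fle.
have dp := is_deriveZ (K * g `^ m) (is_derive1_powR (- m) g0).
have dfp := is_deriveD df dp.
have gm : g `^ m * g `^ (- m) = 1 by rewrite powRN divff// gt_eqF// powR_gt0.
have gm1 : g `^ m * g `^ (- m - 1) = g^-1.
  have -> : - m - 1 = - (m + 1) by ring.
  rewrite powRN powRD; last by rewrite (gt_eqF g0) implybT.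
  rewrite powRr1 ?(ltW g0)//.
  by rewrite invfM mulrA divff ?mul1r// gt_eqF// powR_gt0.
rewrite -subr_le0; have -> : d - K * (m / g) =
    d + (K * g `^ m) *: (- m * g `^ (- m - 1)).
  by rewrite -gm1 /GRing.scale/=; ring.
apply: (derive_le0_left g0 dfp) => y yg; have := fle y yg.
change (f g - f y <= K * (g `^ m * y `^ (- m) - 1) ->
  f g + K * g `^ m * g `^ (- m) <= f y + K * g `^ m * y `^ (- m)).
have -> : K * g `^ m * g `^ (- m) = K by rewrite -mulrA gm mulr1.
lra.
Qed.

End scalar.

(** * Differentiation under the integral sign *)

Lemma is_derive_expRN_mul (R : realType) (c e h : R) :
  is_derive h 1 (fun t : R =>
    c * expR (- (t * e))) (- (c * e * expR (- (h * e)))).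
Proof.
have d1 : is_derive h 1 (fun t : R => - (t * e)) (- e).
  rewrite (_ : (fun t => _) = - e \*: (@id R)); last first.
    by apply/funext => t; rewrite /= /GRing.scale/= mulNr mulrC.
  by apply: is_derive_eq; rewrite scaler1.
have d2 := @is_derive1_comp R expR (fun t : R =>
  - (t * e)) h _ _ (is_derive_expR (- (h * e))) d1.
rewrite (_ : (fun t => _) = c \*: (expR \o (fun t : R => - (t * e))))//.
by apply: is_derive_eq; rewrite /GRing.scale/=; ring.
Qed.

Section moments.
Context {R : realType} (n : nat) (S : set 'rV[R]_n).
Hypothesis mS : measurable S.

(** For [k = 0] and S a decision region this is [Pc] without its normalizing factor; higher [k]
    arise by differentiating in [g]. *)
Definition moment (k : nat) (g : R) : R :=
  \int[lebesgue_rV n]_(x in S) (energy x ^+ k * expR (- (g * energy x))).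

Lemma integrable_moment k (g : R) (D : set 'rV[R]_n) : measurable D -> 0 < g ->
  (lebesgue_rV n).-integrable D
    (EFin \o fun x => energy x ^+ k * expR (- (g * energy x))).
Proof.
move=> mD g0.
apply: (integrableS measurableT mD (@subsetT _ _)).
exact: (@integrable_exprM_expRN_energy R n g k g0).
Qed.

(** Dominated differentiation: for parameters in ]g/2, 2g[ the partial derivative is bounded by
    T^{k+1} e^{-gT/2}, which is integrable. *)
Lemma is_derive_moment k (g : R) : 0 < g ->
  is_derive g 1 (moment k) (- moment k.+1 g).
Proof.
move=> g0.
pose f (h : R) (x : 'rV[R]_n) := energy x ^+ k * expR (- (h * energy x)).
have df (x : 'rV[R]_n) (h : R) :
    is_derive h 1 (f ^~ x) (- (energy x ^+ k.+1 * expR (- (h * energy x)))).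
  by rewrite exprSr; exact: is_derive_expRN_mul.
have g2 : 0 < g / 2 by rewrite divr_gt0.
have Ig : `]g / 2, 2 * g[%classic g by rewrite /= in_itv/=; apply/andP; split;
  lra.
have pos h : `]g / 2, 2 * g[%classic h -> 0 < h.
  by rewrite /= in_itv/= => /andP[+ _]; exact: lt_trans.
have intf h : `]g / 2, 2 * g[%classic h ->
  (lebesgue_rV n).-integrable S (EFin \o f h).
  by move=> /pos h0; exact: integrable_moment.
have derf (h : R) (x : 'rV[R]_n) :
  `]g / 2, 2 * g[%classic h -> S x -> derivable (f ^~ x) h 1.
  by move=> _ _; have [] := df x h.
have G0 (x : 'rV[R]_n) : 0 <= energy x ^+ k.+1 * expR (- (g / 2 * energy x)).
  by rewrite mulr_ge0 ?expR_ge0// exprn_ge0// energy_ge0.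
have dfE (h : R) (x : 'rV[R]_n) :
    partial1of2 f h x = - (energy x ^+ k.+1 * expR (- (h * energy x))).
  by rewrite /partial1of2 derive1E; have [_ ->] := df x h.
have Gub (h : R) (x : 'rV[R]_n) : `]g / 2, 2 * g[%classic h -> S x ->
    `|partial1of2 f h x| <= energy x ^+ k.+1 * expR (- (g / 2 * energy x)).
  move=> hg _; rewrite dfE normrN ger0_norm; last first.
    by rewrite mulr_ge0 ?expR_ge0// exprn_ge0// energy_ge0.
  rewrite ler_wpM2l ?exprn_ge0 ?energy_ge0// ler_expR lerN2.
  rewrite ler_wpM2r ?energy_ge0//.
  by move: hg; rewrite /= in_itv/= => /andP[/ltW].
have intG := integrable_moment k.+1 mS g2.
have D1 := derivable_under_integral mS Ig intf derf G0 intG Gub.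
have D2 := differentiation_under_integral mS Ig intf derf G0 intG Gub.
apply: DeriveDef; first exact: D1.
rewrite -derive1E [LHS]D2.
under eq_Rintegral do rewrite dfE.
rewrite /moment -mulN1r -RintegralZl//; last exact: integrable_moment.
by apply: eq_Rintegral => x _; rewrite mulN1r.
Qed.

End moments.

(** * Flux through the boundary of a star-shaped set *)

Section flux.
Context {R : realType} (n : nat) (S : set 'rV[R]_n).
Hypothesis mS : measurable S.
Hypothesis starS : forall x (t : R), S x -> 0 <= t <= 1 -> S (t *: x).
Let m : R := n%:R / 2.
Let h (t : R) : R := expR (- t) * (t - (m - 1)).

(* The function J of the header. *)
Definition flux (g : R) : R :=
  g `^ m * (g * moment S 1 g - (m - 1) * moment S 0 g).

Let integrable_h (D : set 'rV[R]_n) (g : R) : measurable D -> 0 < g ->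
  (lebesgue_rV n).-integrable D (EFin \o fun x => h (g * energy x)).
Proof.
move=> mD g0.
have i1 := integrable_moment 1 mD g0; have i0 := integrable_moment 0 mD g0.
have := integrableB mD (integrableZl mD g i1) (integrableZl mD (m - 1) i0).
apply: eq_integrable => // x _ /=; rewrite -!EFinM -EFinB; congr (_%:E).
by rewrite /h expr1 expr0; ring.
Qed.

Let fluxE (g : R) : 0 < g ->
  flux g = g `^ m * \int[lebesgue_rV n]_(x in S) h (g * energy x).
Proof.
move=> g0; rewrite /flux /moment; congr (_ * _).
have i1 := integrable_moment 1 mS g0; have i0 := integrable_moment 0 mS g0.
rewrite -!RintegralZl// -RintegralB//; last 2 first.
- exact: (integrableZl mS g i1).
- exact: (integrableZl mS (m - 1) i0).
by apply: eq_Rintegral => x _; rewrite /h expr1 expr0; ring.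
Qed.

(** [W] is the integral of T^{-m} over S \ cS. It is kept in the conclusion because replacing it by
    its upper bound depends on the signs of [Kl] and [Ku]. *)
Lemma flux_diff (V Kl Ku g y : R) : 0 < y < g ->
  lebesgue_rV n (energy_ball n 1) = V%:E ->
  (forall t, 0 < t -> Kl <= t `^ m * h t <= Ku) ->
  exists W, 0 <= W <= V * (expR (n%:R * (ln (g / y) / 2)) - 1) /\
    Kl * W <= flux g - flux y <= Ku * W.
Proof.
move=> /andP[y0 yg] VE hK; have g0 := lt_trans y0 yg.
have gy0 : 0 < g / y by rewrite divr_gt0.
(* Then e^{2a} = g / y, so dilation by e^{-a} turns g T into y T. *)
pose a := ln (g / y) / 2.
have a0 : 0 < a by rewrite divr_gt0// ln_gt0// ltr_pdivlMr// mul1r.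
have a2 : expR a ^+ 2 = g / y by rewrite -expRM_natl mulrC divfK// lnK.
pose D := [set x | S (expR a *: x)].
have mD : measurable D.
  by rewrite -[X in measurable X]setTI; exact: measurable_rV_scale.
have DS : D `<=` S.
  move=> x /(starS (t := (expR a)^-1));
    rewrite scalerA mulVf ?gt_eqF ?expR_gt0//.
  by rewrite scale1r; apply;
    rewrite invr_ge0 expR_ge0/= invf_le1 ?expR_gt0// -expR0 ler_expR ltW.
have mSD : measurable (S `\` D) by exact: measurableD.
(* Substituting e^{-a} x gives the factor e^{na} = (g / y)^m, which turns y^m into g^m; both fluxes
   now have the same integrand. *)
have fy : flux y = g `^ m * \int[lebesgue_rV n]_(x in D) h (g * energy x).
  rewrite fluxE//; have ea0 : 0 < (expR a)^-1 by rewrite invr_gt0 expR_gt0.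
  have := Rintegral_rV_scale ea0 mD (integrable_h mD g0).
  have -> : (fun x => (expR a)^-1 *: x) @^-1` D = S.
    by apply/seteqP; split => x;
      rewrite /D/= scalerA mulfV ?scale1r// gt_eqF// expR_gt0.
  have -> : \int[lebesgue_rV n]_(x in S) h (g * energy ((expR a)^-1 *: x)) =
      \int[lebesgue_rV n]_(x in S) h (y * energy x).
    apply: eq_Rintegral => x _; rewrite energyZ exprVn a2 invf_div mulrA.
    by rewrite [g * _]mulrCA divff ?mulr1 ?gt_eqF.
  move=> ->; rewrite mulrA; congr (_ * _).
  have -> : g = g / y * y by rewrite divfK// gt_eqF.
  rewrite powRM ?(ltW y0) ?(ltW gy0)// mulrC; congr (_ * _).
  rewrite exprVn invrK -a2 -!powR_mulrn ?expR_ge0// -powRrM; congr (_ `^ _).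
  by rewrite /m mulrCA divff ?mulr1 ?pnatr_eq0.
exists (\int[lebesgue_rV n]_(x in S `\` D) (energy x `^ (- m))).
have e0 x : (S `\` D) x -> 0 < energy x.
  move=> [Sx nDx]; rewrite lt_neqAle energy_ge0 andbT eq_sym.
  by apply/eqP => /energy_eq0 x0; apply: nDx; move: Sx; rewrite /D/= x0 scaler0.
have Wle := integral_star_shell mS starS a0 VE.
have mw : measurable_fun (S `\` D) (fun x => (energy x `^ (- m))%:E).
  apply/measurable_EFinP/measurable_funTS.
  have me := @measurable_energy R n.
  exact: (measurableT_comp (measurable_powR (- m)) me).
have intw : (lebesgue_rV n).-integrable (S `\` D) (EFin \o fun x =>
  energy x `^ (- m)).
  apply/integrableP; split => //.
  apply: le_lt_trans (ltry (V * (expR (n%:R * a) - 1))).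
  apply: le_trans Wle; rewrite le_eqVlt; apply/orP; left; apply/eqP.
  by apply: eq_integral => x _; rewrite /= ger0_norm ?powR_ge0.
split.
  rewrite Rintegral_ge0/=; last by move=> x _; exact: powR_ge0.
  rewrite -lee_fin; apply: le_trans Wle; rewrite /Rintegral fineK//.
  exact: (integrable_fin_num mSD intw).
have -> : flux g - flux y =
  g `^ m * \int[lebesgue_rV n]_(x in S `\` D) h (g * energy x).
  rewrite fy fluxE// -mulrBr; congr (_ * _).
  rewrite -[in X in X - _](setDUK DS) Rintegral_setU//.
  - by rewrite addrAC subrr add0r.
  - by rewrite setDUK//; exact: integrable_h.
  - by apply/disj_setPS; rewrite setDIK.
rewrite -!RintegralZl//; last exact: integrable_h.
(* Writing g^m as (g T)^m T^{-m} brings in the function bounded by [hK], at t = g T > 0. *)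
have pt x : (S `\` D) x -> Kl * energy x `^ (- m) <=
  g `^ m * h (g * energy x) <= Ku * energy x `^ (- m).
  move=> /e0 x0; have w0 : 0 < energy x `^ (- m) by exact: powR_gt0.
  have -> : g `^ m * h (g * energy x) =
      ((g * energy x) `^ m * h (g * energy x)) * energy x `^ (- m).
    move: (h _) => z; rewrite powRM ?(ltW g0) ?(ltW x0)// powRN -!mulrA;
      congr (_ * _).
    by rewrite mulrCA divff ?mulr1// gt_eqF// powR_gt0.
  by rewrite !ler_pM2r//; apply: hK; rewrite mulr_gt0.
have iK (K : R) : (lebesgue_rV n).-integrable (S `\` D) (EFin \o fun x =>
  K * energy x `^ (- m)).
  exact: (integrableZl mSD K intw).
have ih : (lebesgue_rV n).-integrable (S `\` D) (EFin \o fun x =>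
  g `^ m * h (g * energy x)).
  exact: (integrableZl mSD (g `^ m) (integrable_h mSD g0)).
by apply/andP; split; apply: le_Rintegral => // x /pt /andP[].
Qed.

End flux.

(** * Second derivative of the error probability *)

Section error_probability_derivatives.
Context {R : realType}.

(** [F1] is known to be the derivative only on the positive reals, which form a neighbourhood of
    [g]. *)
Lemma twice_derivable_is_derive (f F1 : R -> R) (F2 g : R) : 0 < g ->
  (forall t : R, 0 < t -> is_derive t 1 f (F1 t)) -> is_derive g 1 F1 F2 ->
  twice_derivable f g /\ f^`(2)%classic g = F2.
Proof.
move=> g0 df dF1.
have near_gt0 : \forall t \near g, 0 < t by exact: lt_nbhsr.
have near_F1 : \forall t \near g, F1 t = f^`()%classic t.
  near=> t; have t0 : 0 < t by near: t.
  by rewrite derive1E; have [_ ->] := df t t0.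
have d2 : is_derive g 1 f^`()%classic F2
  by exact: near_eq_is_derive near_F1 dF1.
split; first split.
- near=> t; have t0 : 0 < t by near: t.
  by have [] := df t t0.
- by case: d2.
- by rewrite derive1Sn derive1n1 derive1E; case: d2.
Unshelve. all: by end_near. Qed.

Section one_signal.
Variables (n M : nat) (s : 'I_M -> 'rV[R]_n) (i : 'I_M).
Local Notation S := (decision_region s i).

Lemma measurable_decision_region : measurable S.
Proof.
rewrite (_ : S = \bigcap_(j in [set j | j != i])
    [set x | \sum_(k < n) (s j - s i) ord0 k * x ord0 k <=
             2^-1 * enorm (s j - s i) ^+ 2]); last first.
  have dotE (x y : 'rV[R]_n) :
    (y *m x^T) ord0 ord0 = \sum_(k < n) y ord0 k * x ord0 k.
    by rewrite mxE; apply: eq_bigr => k _; rewrite mxE.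
  apply/seteqP; split => [x Sx j /= ji|x Sx j ji].
    by rewrite -dotE; exact: Sx.
  by rewrite dotE; exact: Sx.
apply: fin_bigcap_measurable => [|j _]; first exact: finite_finset.
pose c := 2^-1 * enorm (s j - s i) ^+ 2.
rewrite [X in measurable X](_ : _ = (fun x : 'rV[R]_n =>
  \sum_(k < n) (s j - s i) ord0 k * x ord0 k) @^-1`
  `]-oo, c]); last first.
  by apply/seteqP; split => x /=; rewrite in_itv.
rewrite -[X in measurable X]setTI.
have mf : measurable_fun [set: 'rV[R]_n]
    (fun x : 'rV[R]_n => \sum_(k < n) (s j - s i) ord0 k * x ord0 k).
  apply: measurable_sum => k; apply: measurable_funM => //.
  exact: measurable_rV_coord.
exact: mf.
Qed.

(** The constraints are linear in x with nonnegative right-hand sides. *)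
Lemma decision_region_star (x : 'rV[R]_n) (t : R) :
  S x -> 0 <= t <= 1 -> S (t *: x).
Proof.
move=> Sx /andP[t0 t1] j ji; rewrite linearZ/= -scalemxAr mxE.
have c0 : 0 <= 2^-1 * enorm (s j - s i) ^+ 2 by rewrite mulr_ge0// sqr_ge0.
apply: le_trans (ler_wpM2l t0 (Sx j ji)) _.
by rewrite ler_piMl.
Qed.

Hypothesis n0 : (0 < n)%N.

(** Here Pe = 1 - c0 Q with Q' = (Q - J) / g. Differentiating again, the terms in Q' cancel and Q''
    = - J' / g, so that Pe'' = c0 J' / g. *)
Lemma Pe_second_derivative : exists F1 F2 : R -> R, forall g : R, 0 < g ->
  [/\ is_derive g 1 (Pe s i) (F1 g), is_derive g 1 F1 (F2 g) &
      Bl n / g ^+ 2 <= F2 g <= Bu n / g ^+ 2].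
Proof.
have mS := measurable_decision_region; have starS := decision_region_star.
have [V [VE V0 G0 VG]] := volume_Gamma (R := R) n0.
set G := Gamma _ in G0 VG; set m : R := n%:R / 2 in G G0 VG.
pose c0 : R := (2 * pi) `^ (- m).
have c0_gt0 : 0 < c0 by rewrite powR_gt0// mulr_gt0// pi_gt0.
have pi2_gt0 : 0 < 2 * pi :> R by rewrite mulr_gt0// pi_gt0.
(* From (2 pi)^m = V m G; this removes the unknown volume from the final constants. *)
have cE : c0 * (V * (m * G)) = 1.
  rewrite -VG -powR12_sqrt ?(ltW pi2_gt0)// -powR_mulrn ?powR_ge0//.
  by rewrite -powRrM mulrC [2^-1 * _]mulrC /c0 powRN divff// gt_eqF// powR_gt0.
pose Q (g : R) := g `^ m * moment S 0 g.
pose D1 (g : R) := g^-1 * (Q g - flux S g).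
have PeE (g : R) : 0 < g -> 1 - c0 * Q g = Pe s i g.
  move=> g0; rewrite /Pe /Pc /Q; congr (1 - _).
  rewrite mulrA /moment -RintegralZl//; last exact: integrable_moment.
  apply: eq_Rintegral => x _; rewrite /noise_density expr0 mul1r /energy mulrA.
  by rewrite powRM ?invr_ge0 ?mulr_ge0 ?pi_ge0 ?(ltW g0)// -[(2 *
    pi)^-1]powR_inv1 ?mulr_ge0 ?pi_ge0// -powRrM mulN1r [c0 * _]mulrC.
have dQ (g : R) : 0 < g -> is_derive g 1 Q (D1 g).
  move=> g0.
  have dm := is_deriveM (is_derive1_powR m g0) (is_derive_moment mS 0 g0).
  apply: (is_derive_eq dm); have m0 : 0 < m by rewrite divr_gt0// ltr0n.
  rewrite /D1 /Q /flux -/m -(mulr_powRB1 (ltW g0) m0) /GRing.scale/=; field.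
  by rewrite gt_eqF.
have dflux (g : R) : 0 < g -> derivable (flux S) g 1.
  move=> g0; have d1 := is_deriveM (is_derive_id g 1) (is_derive_moment mS 1
    g0).
  have d0 := is_deriveZ (m - 1) (is_derive_moment mS 0 g0).
  by have [] := is_deriveM (is_derive1_powR m g0) (is_deriveB d1 d0).
exists (fun g => - c0 * D1 g), (fun g => c0 * ((flux S)^`()%classic g / g)) =>
  g g0.
split.
- have dcQ : is_derive g 1 (fun t => 1 - c0 * Q t) (- c0 * D1 g).
    have d := is_deriveB (is_derive_cst (1 : R) g 1) (is_deriveZ c0 (dQ g g0)).
    by apply: (is_derive_eq d); rewrite sub0r mulNr.
  apply: near_eq_is_derive dcQ.
  by near=> t; apply: PeE; near: t; exact: lt_nbhsr.
- have dfl := derivableP (dflux g g0); rewrite -derive1E in dfl.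
  have dV := is_deriveV (lt0r_neq0 g0) (is_derive_id g 1).
  have d := is_deriveZ (- c0) (is_deriveM dV (is_deriveB (dQ g g0) dfl)).
  apply: (is_derive_eq d); rewrite /D1 /GRing.scale/= -[(Q - flux S) g]/(Q g -
    flux S g); field.
  by rewrite gt_eqF.
- have dfl := derivableP (dflux g g0); rewrite -derive1E in dfl.
  have hK t : 0 < t -> Bl n * G <= t `^ m * (expR (- t) * (t - (m - 1))) <=
    Bu n * G.
    by move=> t0; rewrite Bl_le_powR_expRN// powR_expRN_le_Bu.
  have powE y : 0 < y < g -> expR (n%:R * (ln (g / y) / 2)) =
    g `^ m * y `^ (- m).
    move=> /andP[y0 _]; rewrite powRN -[_ / _ in RHS]/(_ * _).
    rewrite /powR !gt_eqF// -expRN -expRD ln_div ?posrE//; congr expR.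
    by rewrite /m; field.
  have up : (flux S)^`()%classic g <= (Bu n * G * V) * (m / g).
    apply: (@is_derive_le_powR _ (flux S) g _ m) => // y yg.
    have [W [/andP[W0 WV] /andP[_ fW]]] := flux_diff mS starS yg VE hK.
    rewrite -powE//; apply: (le_trans fW).
    rewrite -[leRHS]mulrA; apply: ler_wpM2l => //.
    by rewrite mulr_ge0 ?Bu_ge0// ltW.
  (* The lower bound is the upper bound for the negated flux, its constant being nonnegative because
     [Bl] is at most 0. *)
  have dn : - (flux S)^`()%classic g <= (- (Bl n * G) * V) * (m / g).
    apply: (@is_derive_le_powR _ (fun t => - flux S t) g _ m) => //.
    move=> y yg; have [W [/andP[W0 WV] /andP[fW _]]] := flux_diff mS starS yg VE
      hK.
    rewrite -powE// opprK addrC -opprB.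
    apply: (@le_trans _ _ (- (Bl n * G * W))); first by rewrite lerN2.
    rewrite -mulNr -[leRHS]mulrA; apply: ler_wpM2l => //.
    by rewrite oppr_ge0 mulr_le0_ge0 ?Bl_le0// ltW.
  have cg : 0 < c0 / g by rewrite divr_gt0.
  have scale B : c0 * (B * G * V * (m / g) / g) = B / g ^+ 2.
    transitivity (B * (c0 * (V * (m * G))) / g ^+ 2); last by rewrite cE mulr1.
    by field; rewrite gt_eqF.
  rewrite -(scale (Bl n)) -(scale (Bu n)); apply/andP; split.
    rewrite ler_pM2l// ler_pM2r ?invr_gt0//.
    by rewrite -lerN2; apply: (le_trans dn); rewrite !mulNr.
  by rewrite ler_pM2l// ler_pM2r ?invr_gt0.
Unshelve. all: by end_near. Qed.

End one_signal.
End error_probability_derivatives.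

Theorem theorem7 (R : realType) (n M : nat) (s : 'I_M -> 'rV[R]_n)
  (p : 'I_M -> R) :
  (1 <= n)%N -> constellation s -> prior p ->
  forall g : R, 0 < g ->
    (twice_derivable (Pe_avg s p) g /\
     Bl n / g ^+ 2 <= ((Pe_avg s p)^`(2))%classic g <= Bu n / g ^+ 2) /\
    (forall i : 'I_M,
      twice_derivable (Pe s i) g /\
      Bl n / g ^+ 2 <= ((Pe s i)^`(2))%classic g <= Bu n / g ^+ 2).
Proof.
move=> n0 _ [p0 p1] g g0.
(* Choosing the derivatives as functions of i lets the average be differentiated term by term. *)
have /choice[F1 /choice[F2 H]] := fun i => @Pe_second_derivative R n M s i n0.
split; last first.
  move=> i; have [td ->] := twice_derivable_is_derive g0
    (fun t t0 => let: And3 d _ _ := H i t t0 in d) (let: And3 _ d _ := H i g g0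
      in d).
  by have [_ _] := H i g g0.
have dsum (f df : 'I_M -> R -> R) (t : R) :
  (forall i, is_derive t 1 (f i) (df i t)) ->
    is_derive t 1 (fun t => \sum_(i < M) f i t * p i) (\sum_(i < M) df i t * p
      i).
  move=> d; have di i : is_derive t 1 (fun t => f i t * p i) (df i t * p i).
    rewrite mulrC (_ : (fun t => _) = p i \*: f i); first exact: is_deriveZ.
    by apply/funext => u; rewrite mulrC.
  rewrite (_ : (fun t => _) = \sum_(i < M) (fun t => f i t * p i)); last first.
    by apply/funext => u; rewrite fct_sumE.
  exact: is_derive_sum.
have [td ->] := twice_derivable_is_derive g0
  (fun t t0 => dsum _ _ t (fun i => let: And3 d _ _ := H i t t0 in d))
  (dsum _ _ g (fun i => let: And3 _ d _ := H i g g0 in d)).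
split=> //.
(* The priors sum to 1, so each bound is its own weighted average and the comparison is termwise. *)
have sp (c : R) : c = \sum_(i < M) c * p i by rewrite -mulr_sumr p1 mulr1.
rewrite [X in X <= _ <= _]sp [X in _ <= _ <= X]sp; apply/andP; split.
  by apply: ler_sum => i _; rewrite ler_wpM2r//; have [_ _ /andP[]] := H i g g0.
by apply: ler_sum => i _; rewrite ler_wpM2r//; have [_ _ /andP[]] := H i g g0.
Qed.
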